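(* Assume that $X[\mathcal{T}]$ is a locally convex topological vector space, $\mathcal{C}$ is a non-decreasing countable localizing family in $X$, and each member of $\mathcal{C}$ is $\mathcal{T}$-closed. The following hold. (A) A sequence $\langle x_j\rangle_j$ in $X$ converges to $x\in X$ with respect to $\mathcal{T}_{\mathcal{C}}$ if and only if it converges to $x$ with respect to $\mathcal{T}$ and is contained in some $C\in\mathcal{C}$. (B) A set $B\subseteq X$ is $\mathcal{T}_{\mathcal{C}}$-bounded if and only if it is $\mathcal{T}$-bounded and contained in some $C\in\mathcal{C}$. (C) If $Y$ is a vector subspace of $X$ and its topology $\mathcal{T}_{\mathcal{C}}|_Y$ is sequential then $\mathcal{T}_{\mathcal{C}}|_Y=(\mathcal{T}|_Y)_{\mathcal{C}|_Y}$.
   Context: All vector spaces are real; topological vector spaces are Hausdorff. $X[\mathcal{T}]$ denotes $X$ equipped with the topology $\mathcal{T}$; for a collection $\mathcal{T}$ of subsets of $X$ and $C\subseteq X$, $\mathcal{T}|_C=\{E\cap C:E\in\mathcal{T}\}$ (so $\mathcal{C}|_Y=\{C\cap Y:C\in\mathcal{C}\}$, which is a localizing family in $Y$). A localizing family in a vector space $X$ is a non-empty collection $\mathcal{C}$ of convex subsets of $X$ containing $0$ such that for all $C\in\mathcal{C}$, $x\in X$, $t\in\mathbb{R}$ there is $D\in\mathcal{C}$ with $x+t\cdot C\subseteq D$. It is non-decreasing countable if it can be numbered $\mathcal{C}=\{C_k:k\in\mathbb{N}\}$ with $C_k\subseteq C_{k+1}$ for all $k$. The localization $\mathcal{T}_{\mathcal{C}}$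 is the locally convex vector topology on $X$ consisting of all $E\subseteq X$ such that for every $x\in E$ there is a convex $V$ with $x\in V\subseteq E$ and $V\cap C\in\mathcal{T}|_C$ for every $C\in\mathcal{C}$. A Hausdorff topology is sequential if every sequentially closed set (one containing the limits of all its convergent sequences) is closed. *)

(* Defs.v *)
From HB Require Import structures.
From mathcomp Require Import all_boot all_order all_algebra.
From mathcomp Require Import all_classical all_reals all_analysis.

Set Implicit Arguments.
Unset Strict Implicit.
Unset Printing Implicit Defensive.

Import Order.TTheory GRing.Theory Num.Theory.

Local Open Scope classical_set_scope.
Local Open Scope ring_scope.

Definition trace (X : Type) (T : set (set X)) (A : set X) : set (set X) :=
  [set E `&` A | E in T].

(* A family of subsets of X, restricted to a subspace of X with inclusion i. *)
Definition restriction (X Y : Type) (i : Y -> X) (S : set (set X)) :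
    set (set Y) :=
  [set i @^-1` A | A in S].

Section Localization.
Context {R : realType} {X : lmodType R}.
Implicit Types (T CC : set (set X)).

Definition localizing_family CC : Prop :=
  [/\ CC !=set0,
      forall C, CC C -> convex_set C /\ C 0
    & forall C x t, CC C ->
        exists2 D, CC D & [set x + t *: y | y in C] `<=` D].

Definition nondecreasing_countable CC : Prop :=
  exists C_ : nat -> set X,
    CC = range C_ /\ forall k, C_ k `<=` C_ k.+1.

Definition localization T CC : set (set X) :=
  [set E : set X | forall x : X, E x -> exists V : set X,
    [/\ convex_set V, V x, V `<=` E
      & forall C, CC C -> trace T C (V `&` C)]].

End Localization.

(* A copy of X carrying the localization by CC of the topology of X. *)
Definition localized (R : realType) (X : preTopologicalLmodType R)
  (CC : set (set X)) : Type := X.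

Section LocalizedTopology.
Context {R : realType} {X : preTopologicalLmodType R} (CC : set (set X)).

Let op : set (set X) := localization open CC.

Let opT : op setT.
Proof.
move=> x _; exists setT; split=> // C _; exists setT => //; exact: openT.
Qed.

Let opI : setI_closed op.
Proof.
move=> A B oA oB x [Ax Bx].
have [V [cV Vx VA VC]] := oA x Ax; have [W [cW Wx WB WC]] := oB x Bx.
exists (V `&` W); split=> //.
- move=> a b t; rewrite !inE => -[Va Wa] [Vb Wb]; split.
  + by have := cV a b t (mem_set Va) (mem_set Vb); rewrite inE.
  + by have := cW a b t (mem_set Wa) (mem_set Wb); rewrite inE.
- by move=> y [/VA Ay /WB By].
- move=> C CCC; have [U oU UE] := VC C CCC; have [U' oU' U'E] := WC C CCC.
  exists (U `&` U'); first exact: openI.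
  by rewrite setIIl UE U'E -setIIl.
Qed.

Let op_bigU (I : Type) (f : I -> set X) :
  (forall i, op (f i)) -> op (\bigcup_i f i).
Proof.
move=> of_ x [i _ fix_]; have [V [cV Vx Vf VC]] := of_ i x fix_.
by exists V; split=> // y /Vf; exists i.
Qed.

HB.instance Definition _ := GRing.Lmodule.on (@localized R X CC).
HB.instance Definition _ := Choice.on (@localized R X CC).
HB.instance Definition _ :=
  isOpenTopological.Build (@localized R X CC) opT opI op_bigU.

Lemma open_localizedE :
  @open (localized CC) = localization (@open X) CC.
Proof. by []. Qed.

End LocalizedTopology.

(* Boundedness in the sense of topological vector spaces: absorption by every
   neighborhood of the origin. *)
Definition tvs_bounded (R : realType) (X : preTopologicalLmodType R)
    (B : set X) : Prop :=
  forall U : set X, nbhs (0 : X) U ->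
    exists2 r : R, 0 < r & forall t : R, r < t -> B `<=` [set t *: y | y in U].

Arguments tvs_bounded {R} X B.

(* Convergence in X, with X explicit in order to tell apart topologies living
   on convertible carriers. *)
Definition seq_cvg (X : topologicalType) (u : nat -> X) (x : X) : Prop :=
  u @ \oo --> x.

Arguments seq_cvg X u x : clear implicits.

Definition seq_closed (X : topologicalType) (A : set X) : Prop :=
  forall (u : nat -> X) (l : X), (forall n, A (u n)) -> seq_cvg X u l -> A l.

(* Used for Hausdorff X only; separation is not part of the definition. *)
Definition sequential (X : topologicalType) : Prop :=
  forall A : set X, seq_closed A -> closed A.

Lemma open_initialE (Y : choiceType) (X : topologicalType) (i : Y -> X) :
  @open (initial_topology i) = restriction i (@open X).
Proof. by []. Qed.

(* Main.v *)
(* If y_k lies outside the closed convex set C_k, then C_k + W_k is a convex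
   open set that contains C_k and misses y_k, for a small convex neighborhood
   W_k of the origin. The intersection of these sets has an open trace on every
   C_m, because C_m is contained in all but finitely many of them; it is thus
   open in the localization, although it misses every y_k. Hence a sequence
   convergent, or a set bounded, for the localization cannot leave every C_k
   (for bounded sets, apply this to y_k = b_k / (k + 1)). On a single C_k the
   two topologies have the same trace, which gives the converses, and shows
   that the complement of a member of the localization in Y is sequentially
   closed for the topology induced by the localization in X. *)
Require Import Defs.
From HB Require Import structures.
From mathcomp Require Import all_boot all_order all_algebra.
From mathcomp Require Import all_classical all_reals all_analysis.

Set Implicit Arguments.
Unset Strict Implicit.
Unset Printing Implicit Defensive.

Import Order.TTheory GRing.Theory Num.Theory.

Local Open Scope classical_set_scope.
Local Open Scope ring_scope.

Lemma tvs_convex_open_nbhs (R : realType) (X : tvsType R) (x : X) (A : set X) :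
  nbhs x A ->
  exists V : set X, [/\ convex_set V, open V, V x & V `<=` A].
Proof.
move=> xA; have [B Bconv [Bo Bx]] := @locally_convex R X.
have [V [BV Vx] VA] := Bx x _ xA.
by exists V; split => //; [exact/Bconv/mem_set | exact: Bo].
Qed.

Lemma closed_convex_open_separation (R : realType) (X : tvsType R)
    (C : set X) (y : X) : convex_set C -> closed C -> ~ C y ->
  exists V : set X, [/\ convex_set V, open V, C `<=` V & ~ V y].
Proof.
move=> cC clC nCy.
(* Continuity of subtraction at [(y, 0)] keeps [y - w] off [C] for small [w]. A convex open [W] of
   such [w] gives [C + W], which then misses [y]. *)
have : nbhs (0 : X) [set w | ~ C (y - w)].
  have [/= [A B] [/= yA B0] AB] : nbhs (y, 0 : X) [set z | ~ C (z.1 - z.2)].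
    have yC : nbhs ((y, 0 : X).1 - (y, 0 : X).2) (~` C).
      rewrite /= subr0.
      by apply: open_nbhs_nbhs; split => //; exact: closed_openC.
    exact: (sub_continuous yC).
  by apply: filterS B0 => w Bw; apply: (AB (y, w)); split => //;
    exact: nbhs_singleton.
move=> /tvs_convex_open_nbhs[W [cW oW W0 WC]].
exists [set z | exists2 c, C c & W (z - c)]; split.
- move=> a b t; rewrite !inE => -[c Cc Wac] [d Cd Wbd].
  exists (t%:num *: c + (1 - t%:num) *: d).
    by have := cC c d t (mem_set Cc) (mem_set Cd); rewrite inE.
  have := cW _ _ t (mem_set Wac) (mem_set Wbd); rewrite inE.
  by rewrite /conv/= !scalerBr addrACA -opprD.
(* The sum is a union of the open translates [c + W]. *)
- rewrite openE => z [c Cc Wzc].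
  have := nbhsB c (open_nbhs_nbhs (conj oW Wzc)); rewrite addrC subrK.
  apply: filterS => _ [w Ww <-]; exists c => //.
  by rewrite addrC addKr.
- by move=> c Cc; exists c => //; rewrite subrr.
- by move=> [c Cc /WC]; rewrite /= subKr.
Qed.

Lemma openI_initial_segment (X : topologicalType) (V : nat -> set X) (n : nat) :
  (forall k, open (V k)) -> open [set x | forall k, (k < n)%N -> V k x].
Proof.
move=> oV; elim: n => [|n IH].
  by rewrite (_ : [set _ | _] = setT) ?predeqE//; exact: openT.
rewrite (_ : [set _ | _] = [set x | forall k, (k < n)%N -> V k x] `&` V n).
  exact: openI.
rewrite predeqE => x; split=> [Vx|[Vx Vn] k].
  by split=> [k kn|]; apply: Vx => //; exact: ltnW.
by rewrite ltnS leq_eqVlt => /orP[/eqP->|/Vx].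
Qed.

Lemma nondecreasing_set (X : Type) (C : nat -> set X) :
  (forall k, C k `<=` C k.+1) ->
  forall m n, (m <= n)%N -> C m `<=` C n.
Proof.
by move=> Cs m n /subnK <-; elim: (n - m)%N => // k IH x /IH /Cs.
Qed.

Lemma nondecreasing_sequence_separation (R : realType) (X : tvsType R)
    (C : nat -> set X) (y : nat -> X) :
  (forall k, convex_set (C k)) -> (forall k, closed (C k)) ->
  (forall k, C k `<=` C k.+1) -> (forall k, ~ C k (y k)) ->
  exists V : set X, [/\ convex_set V, C 0%N `<=` V, (forall k, ~ V (y k))
    & forall m, trace open (C m) (V `&` C m)].
Proof.
move=> cC clC Cs nCy.
have /choice[V VP] k :=
  closed_convex_open_separation (cC k) (clC k) (nCy k).
have cV k : convex_set (V k) by have [] := VP k.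
have oV k : open (V k) by have [] := VP k.
have CV k : C k `<=` V k by have [] := VP k.
exists (\bigcap_k V k); split.
- move=> a b t; rewrite !inE => Va Vb k _.
  by have := cV k a b t (mem_set (Va k I)) (mem_set (Vb k I)); rewrite inE.
- by move=> x Cx k _; apply/CV/(nondecreasing_set Cs (leq0n k)).
- by move=> k /(_ k I); have [] := VP k.
- move=> m; exists [set x | forall k, (k < m)%N -> V k x].
    exact: openI_initial_segment.
  rewrite predeqE => x; split=> [[Vx Cx]|[Vx Cx]]; split=> // k; last first.
    by move=> _; exact: Vx.
  by move=> _; have [/Vx//|mk] := ltnP k m;
    exact/CV/(nondecreasing_set Cs mk).
Qed.

(** A convex set with open traces is open in the localization, since it is its own witness at each
    of its points. *)
Lemma nbhs_localizedP (R : realType) (X : preTopologicalLmodType R)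
    (CC : set (set X)) (x : X) (A : set X) :
  nbhs (x : localized CC) A <->
  exists V : set X, [/\ convex_set V, V x, V `<=` A
    & forall C, CC C -> trace open C (V `&` C)].
Proof.
rewrite nbhsE; split=> [[B [oB Bx] BA]|[V [cV Vx VA tV]]].
  have [V [cV Vx VB tV]] := oB x Bx.
  by exists V; split => //; exact: subset_trans BA.
exists V => //; split => //; rewrite open_localizedE => z Vz.
by exists V; split.
Qed.

Lemma nbhs_localized (R : realType) (X : tvsType R) (CC : set (set X))
    (x : X) (A : set X) :
  nbhs x A -> nbhs (x : localized CC) A.
Proof.
move=> /tvs_convex_open_nbhs[V [cV oV Vx VA]]; apply/nbhs_localizedP.
by exists V; split => // C _; exists V.
Qed.

Section LocalizedConvergence.
Context {R : realType} {X : tvsType R} {CC : set (set X)}.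
Hypothesis hCC : localizing_family CC.
Hypothesis hcount : nondecreasing_countable CC.
Hypothesis hclosed : forall C : set X, CC C -> closed C.

(** Stated for a cofinal sequence of members rather than a full enumeration, so that it applies to a
    tail whose first set contains [x]. *)
Lemma nbhs_localized_avoiding (C : nat -> set X) (y : nat -> X) (x : X) :
  (forall k, CC (C k)) -> (forall k, C k `<=` C k.+1) ->
  (forall D, CC D -> exists k, D `<=` C k) -> C 0%N x ->
  (forall k, ~ C k (y k)) ->
  exists2 V : set X, nbhs (x : localized CC) V & forall k, ~ V (y k).
Proof.
move=> CCk Cs Ccofinal Cx nCy; have [_ CC0 _] := hCC.
have [V [cV CV nVy tV]] : exists V : set X,
    [/\ convex_set V, C 0%N `<=` V, (forall k, ~ V (y k))
      & forall m, trace open (C m) (V `&` C m)].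
  apply: nondecreasing_sequence_separation => // k; last exact: hclosed.
  by have [] := CC0 _ (CCk k).
exists V => //; apply/nbhs_localizedP; exists V; split=> //; first exact: CV.
move=> D /Ccofinal[m DCm]; have [U oU UE] := tV m; exists U => //.
by rewrite -(setIidr DCm) !setIA UE.
Qed.

Lemma seq_cvg_localized (u : nat -> X) (x : X) :
  seq_cvg (localized CC) u x <->
  seq_cvg X u x /\ (exists2 C, CC C & forall j, C (u j)).
Proof.
have [C [CE Cs]] := hcount; have [_ CC0 CCt] := hCC.
have CCk k : CC (C k) by rewrite CE; exists k.
(* Some member contains [z + C 0], hence [z] itself, because [C 0] contains the origin. *)
have covered z : exists k, C k z.
  have [D] := CCt _ z 1 (CCk 0%N); rewrite CE => -[k _ <-] CD; exists k.
  apply: CD; exists 0; last by rewrite scaler0 addr0.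
  by have [] := CC0 _ (CCk 0%N).
split=> [ux|[ux [D CCD Du]] A].
- split; first by move=> A xA; exact/ux/nbhs_localized.
  apply: contrapT => nu.
  have /choice[j nCj] k : exists j, ~ C k (u j).
    by apply/existsNP => Cu; apply: nu; exists (C k).
  have [K CKx] := covered x.
  have [V xV nVu] : exists2 V : set X, nbhs (x : localized CC) V &
      forall k, ~ V (u (j (K + k)%N)).
    apply: (@nbhs_localized_avoiding (fun k => C (K + k)%N)) => //.
    + by move=> k; rewrite addnS; exact: Cs.
    + move=> D; rewrite CE => -[k _ <-]; exists k.
      exact/(nondecreasing_set Cs)/leq_addl.
    + by rewrite addn0.
  have [N _ NV] := ux _ xV.
  (* Nothing makes [j] monotone. The terms before [N] share one [C M], whereas [u (j (K + M))] lies
     outside the larger [C (K + M)]. Its index is thus at least [N], and [NV] puts this term in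
     [V]. *)
  have [M CMu] : exists M, forall i, (i < N)%N -> C M (u i).
    elim: N {NV} => [|N [M CMu]]; first by exists 0%N.
    have [M' CM'u] := covered (u N); exists (M + M')%N => i.
    rewrite ltnS leq_eqVlt => /orP[/eqP->|/CMu].
      exact/(nondecreasing_set Cs (leq_addl M M')).
    exact/(nondecreasing_set Cs (leq_addr M' M)).
  apply: (nVu M); apply: NV => /=; rewrite leqNgt; apply/negP => /CMu.
  by move=> /(nondecreasing_set Cs (leq_addl K M)); exact: nCj.
- move=> /nbhs_localizedP[V [cV Vx VA tV]]; have [U oU UE] := tV D CCD.
  (* Closedness of [D] places the limit in [D], where [U] and [V] agree. *)
  have Dx : D x.
    by apply: (@closed_cvg _ X \oo _ u D (hclosed CCD) _ x ux); exact: nearW.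
  have Ux : U x by have [] : (U `&` D) x by rewrite UE.
  have : nbhs x U by exact: open_nbhs_nbhs.
  move=> /ux; apply: (@filterS _ \oo) => i Uui; apply: VA.
  by have [] : (V `&` D) (u i) by rewrite -UE; split=> //; exact: Du.
Qed.

Lemma tvs_bounded_localized (B : set X) :
  tvs_bounded (localized CC) B <->
  tvs_bounded X B /\ (exists2 C, CC C & B `<=` C).
Proof.
have [C [CE Cs]] := hcount; have [_ CC0 CCt] := hCC.
have CCk k : CC (C k) by rewrite CE; exists k.
split=> [bB|[bB [D CCD BD]] A].
- split; first by move=> A A0; exact/bB/nbhs_localized.
  apply: contrapT => nB.
  have /choice[b Pb] k : exists b, B b /\ ~ C k (k.+1%:R^-1 *: b).
    (* As [D] contains [(k + 1) C k], a point of [B] outside [D] remains outside [C k] after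
       division by [k + 1]. *)
    have [D] := CCt _ 0 k.+1%:R (CCk k); move=> CCD kCD.
    apply: contrapT => /forallNP nb; apply: nB; exists D => // z Bz.
    apply: contrapT => nDz; apply: (nb z); split=> // Cz; apply/nDz/kCD.
    by exists (k.+1%:R^-1 *: z); rewrite // add0r scalerA divff ?scale1r.
  have [V V0 nVb] : exists2 V : set X, nbhs (0 : localized CC) V &
      forall k, ~ V (k.+1%:R^-1 *: b k).
    apply: (@nbhs_localized_avoiding C) => //.
    + by move=> D; rewrite CE => -[k _ <-]; exists k.
    + by have [] := CC0 _ (CCk 0%N).
    + by move=> k; have [] := Pb k.
  have [r r0 BV] := bB V V0.
  (* Since [k + 1 > r], absorption writes [b k] as [(k + 1) z] with [z] in [V], against the choice
     of [V]. *)
  pose k := Num.trunc r.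
  have /BV : r < k.+1%:R by rewrite truncnS_gt.
  move=> /(_ (b k))[|z Vz zb]; first by have [] := Pb k.
  by apply: (nVb k); rewrite -zb scalerA mulVf ?scale1r.
- move=> /nbhs_localizedP[V [cV V0 VA tV]].
  have [cD D0] := CC0 _ CCD; have [U oU UE] := tV D CCD.
  have [|r r0 BU] := bB U.
    by apply: open_nbhs_nbhs; split=> //; have [] : (U `&` D) 0 by rewrite UE.
  (* The bound 1 makes [z / t] a convex combination of [z] and 0, so it stays in [D], where
     membership in [U] yields membership in [V]. *)
  exists (Num.max r 1); first by rewrite lt_max r0.
  move=> t; rewrite gt_max => /andP[rt t1] z Bz.
  have t0 : 0 < t by exact: lt_trans t1.
  have [w Uw wz] := BU _ rt _ Bz; exists w => //; apply: VA.
  suff Dw : D w by have [] : (V `&` D) w by rewrite -UE.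
  have t01 : 0 <= t^-1 <= 1.
    by rewrite invr_ge0 ltW//= invf_le1// ltW.
  have := cD z 0 (Itv01 (proj1 (andP t01)) (proj2 (andP t01)))
    (mem_set (BD _ Bz)) (mem_set D0).
  by rewrite inE /conv/= scaler0 addr0 -wz scalerA mulVf ?gt_eqF// scale1r.
Qed.

(** Convexity and open traces both pull back along the linear inclusion [\val]. *)
Lemma restriction_localization (P : pred X) (Y : subLmodType P) :
  restriction (\val : Y -> X) (localization open CC) `<=`
  @localization R Y (restriction \val open) (restriction \val CC).
Proof.
move=> _ [E oE <-] y /oE[V [cV Vy VE tV]]; exists (\val @^-1` V); split=> //.
- move=> a b t; rewrite !inE => Va Vb.
  have := cV _ _ t (mem_set Va) (mem_set Vb).
  by rewrite inE /conv/= GRing.valD !GRing.valZ.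
- by move=> z /VE.
- move=> _ [D CCD <-]; have [U oU UE] := tV D CCD.
  exists (\val @^-1` U); first by exists U.
  by rewrite -preimage_setI UE preimage_setI.
Qed.

Lemma sequential_restriction_localization (P : pred X) (Y : subLmodType P) :
  sequential (initial_topology (\val : Y -> localized CC)) ->
  @localization R Y (restriction \val open) (restriction \val CC) `<=`
  restriction (\val : Y -> X) (localization open CC).
Proof.
move=> seqY F oF.
pose W := initial_topology (\val : Y -> localized CC).
have : @open W F.
  rewrite -closedC; apply: seqY => u l nFu ul Fl.
  have /seq_cvg_localized[ux [D CCD Du]] :
      seq_cvg (localized CC) (\val \o u) (\val l).
    apply: (@cvg_comp _ _ _ u _ _ (nbhs (l : W))) => //.
    exact: initial_continuous.
  have [V [cV Vl VF tV]] := oF l Fl.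
  have [|_ [U oU <-] UE] := tV (\val @^-1` D); first by exists D.
  have Dl : D (\val l).
    by apply: (@closed_cvg _ X \oo _ _ D (hclosed CCD) _ _ ux); exact: nearW.
  have Ul : U (\val l).
    by have [] : (\val @^-1` U `&` \val @^-1` D) l by rewrite UE.
  (* A single term in [U] suffices: it also lies in [D], hence in [V] and in [F], which the sequence
     avoids. *)
  have [N _ /(_ N (leqnn N)) UuN] : \forall n \near \oo, U (\val (u n)).
    by apply: ux; apply: open_nbhs_nbhs.
  suff /VF : V (u N) by exact: nFu.
  have : (\val @^-1` U `&` \val @^-1` D) (u N).
    split; [exact: UuN | exact: Du].
  by rewrite UE => -[].
by move=> [E oE <-]; exists E.
Qed.

End LocalizedConvergence.

Theorem theorem3p1 (R : realType) (X : tvsType R) (CC : set (set X))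
  (hX : hausdorff_space X)
  (hCC : localizing_family CC)
  (hcount : nondecreasing_countable CC)
  (hclosed : forall C : set X, CC C -> closed C) :
  [/\ (* (A) *)
      forall (u : nat -> X) (x : X),
        seq_cvg (localized CC) u x <->
        seq_cvg X u x /\ (exists2 C, CC C & forall j, C (u j)),
      (* (B) *)
      forall B : set X,
        tvs_bounded (localized CC) B <->
        tvs_bounded X B /\ (exists2 C, CC C & B `<=` C)
    & (* (C) *)
      forall (P : pred X) (Y : subLmodType P),
        sequential (initial_topology (\val : Y -> localized CC)) ->
        restriction (\val : Y -> X) (localization (@open X) CC) =
        @localization R Y (restriction (\val : Y -> X) (@open X))
          (restriction (\val : Y -> X) CC) ].
Proof.
split=> [u x|B|P Y seqY].
- exact: seq_cvg_localized.
- exact: tvs_bounded_localized.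
- rewrite eqEsubset; split; first exact: restriction_localization.
  exact: sequential_restriction_localization.
Qed.
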